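(* Let $h>0$, let $B\subset\mathbb Z^8_h$ be bounded and let $f:\overline B\to\mathbb O$. Then: (i) $D^h\big(C^h_{\partial B}f\big)(y)=0$ for every $y\in B^\circ\cup(\mathbb Z^8_h\setminus B)^\circ$; (ii) if $f(y)=C^h_{\partial B}f(y)$ for every $y\in B$, then $D^hf(y)=0$ for every $y\in B^\circ$.
   Context: $\mathbb O$ is the real octonion algebra with basis $\mathbf e_0=1,\mathbf e_1,\dots,\mathbf e_7$, where $\mathbf e_i\mathbf e_j=-\delta_{ij}+\sum_k\varepsilon_{ijk}\mathbf e_k$ for $1\le i,j\le 7$, $\varepsilon_{ijk}$ totally antisymmetric with $\varepsilon_{ijk}=1$ for $ijk\in\{123,145,176,246,257,347,365\}$; $\overline{\mathbf e}_0=\mathbf e_0$, $\overline{\mathbf e}_l=-\mathbf e_l$ ($l\ge1$). For $h>0$, $\mathbb Z^8_h=(h\mathbb Z)^8$, $e_0,\dots,e_7$ are the standard unit vectors of $\mathbb R^8$, $\chi_A$ is the indicator of $A$. Difference operators: $\partial_l^{+,h}f(x)=(f(x+he_l)-f(x))/h$, $\partial_l^{-,h}f(x)=(f(x)-f(x-he_l))/h$, $\partial_l^h=\frac12(\partial_l^{+,h}+\partial_l^{-,h})$, $D^hf=\sum_{l=0}^7\mathbf e_l\partial_l^hf$. $N(x)=\{x,x\pm he_0,\dots,x\pm he_7\}$; for $A\subset\mathbb Z^8_h$: $\partial A=\{x:\ N(x)\cap A\neq\emptyset,\ N(x)\cap(\mathbb Z^8_h\setminus A)\neq\emptyset\}$,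 $\overline A=A\cup\partial A$, $A^\circ=A\setminus\partial A$. For $x\in\partial B$: $\Sigma(x)=\sum_l[(\partial_l^{+,h}\chi_B(x))^2+(\partial_l^{-,h}\chi_B(x))^2]$, $s(x)=\frac{h^8}{2}\sqrt{\Sigma(x)}$, $n_l^\pm(x)=-2\partial_l^{\pm,h}\chi_B(x)/\sqrt{\Sigma(x)}$, $\int_{\partial B}g\,dS=\sum_{x\in\partial B}g(x)s(x)$. Fundamental solution: $E^1(x)=\frac{1}{(2\pi)^8}\int_{[-\pi,\pi]^8}\frac{\sum_l\overline{\mathbf e}_l\sin u_l}{\sum_l\sin^2u_l}\sin(\sum_lu_lx_l)\,du$ ($x\in\mathbb Z^8$), $E^h(x)=h^{-7}E^1(x/h)$. Star product: $K^h(x,y)*g(x)=-\frac12\sum_{l=0}^7\big(E^h(he_l-x+y)n_l^-(x)+E^h(-he_l-x+y)n_l^+(x)\big)(\mathbf e_lg(x))$ for $x\in\partial B$, $y\in\mathbb Z^8_h$. Discrete Cauchy-Bitsadze operator: $C^h_{\partial B}g(y)=\int_{\partial B}K^h(x,y)*g(x)\,dS(x)$ for $y\in\mathbb Z^8_h$ and $g:\partial B\to\mathbb O$. *)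

(* Defs.v *)
From HB Require Import structures.
From mathcomp Require Import all_boot all_order all_algebra.
From mathcomp Require Import all_classical all_reals all_analysis.
Set Implicit Arguments. Unset Strict Implicit. Unset Printing Implicit Defensive.
Import Order.TTheory GRing.Theory Num.Theory.
Import numFieldNormedType.Exports.
Local Open Scope classical_set_scope.
Local Open Scope ring_scope.

Section Octonions.
Variable R : realType.

(* Octonions: coordinate vectors (a_0,...,a_7) w.r.t. e_0=1,e_1,...,e_7. *)
Definition oct := 'rV[R]_8.

Definition obasis (l : 'I_8) : oct := \row_k (k == l)%:R.

Definition eps_triples : seq (nat * nat * nat) :=
  [:: (1,2,3); (1,4,5); (1,7,6); (2,4,6); (2,5,7); (3,4,7); (3,6,5)]%N.

Definition cyc_in (i j k : nat) : bool :=
  ((i, j, k) \in eps_triples) || ((j, k, i) \in eps_triples)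
  || ((k, i, j) \in eps_triples).

Definition eps (i j k : nat) : R :=
  if cyc_in i j k then 1 else if cyc_in j i k then -1 else 0.

(* structure constants: e_i e_j = sum_k omul_coef i j k e_k *)
Definition omul_coef (i j k : 'I_8) : R :=
  if i == 0 :> nat then (j == k)%:R
  else if j == 0 :> nat then (i == k)%:R
  else if i == j then - (k == 0 :> nat)%:R
  else eps i j k.

Definition omul (a b : oct) : oct :=
  \row_k \sum_(i < 8) \sum_(j < 8) a 0 i * b 0 j * omul_coef i j k.

Definition oconj (a : oct) : oct :=
  \row_k (if k == 0 :> nat then a 0 k else - a 0 k).

(* Points of Z^8_h = (hZ)^8 are represented by their integer coordinates:
   z : 'rV[int]_8 stands for the point h*z. *)
Definition pt := 'rV[int]_8.
Definition ue (l : 'I_8) : pt := \row_k (k == l)%:R.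

Definition dplus (h : R) (l : 'I_8) (g : pt -> oct) (x : pt) : oct :=
  h^-1 *: (g (x + ue l) - g x).
Definition dminus (h : R) (l : 'I_8) (g : pt -> oct) (x : pt) : oct :=
  h^-1 *: (g x - g (x - ue l)).
Definition dcen (h : R) (l : 'I_8) (g : pt -> oct) (x : pt) : oct :=
  2^-1 *: (dplus h l g x + dminus h l g x).
Definition Dh (h : R) (g : pt -> oct) (x : pt) : oct :=
  \sum_(l < 8) omul (obasis l) (dcen h l g x).

Definition dplusR (h : R) (l : 'I_8) (g : pt -> R) (x : pt) : R :=
  (g (x + ue l) - g x) / h.
Definition dminusR (h : R) (l : 'I_8) (g : pt -> R) (x : pt) : R :=
  (g x - g (x - ue l)) / h.

Definition nbh (x y : pt) : Prop :=
  y = x \/ exists l : 'I_8, y = x + ue l \/ y = x - ue l.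

Definition lbound (A : set pt) : set pt :=
  [set x | (exists2 y, nbh x y & A y) /\ (exists2 y, nbh x y & ~ A y)].
Definition lclosure (A : set pt) : set pt := A `|` lbound A.
Definition linterior (A : set pt) : set pt := A `\` lbound A.

Definition lbounded (A : set pt) : Prop :=
  exists M : nat, forall z, A z -> forall i : 'I_8, `|z 0 i| <= M%:R.

Definition chi (B : set pt) : pt -> R := \1_B.

Definition Sigma (h : R) (B : set pt) (x : pt) : R :=
  \sum_(l < 8) (dplusR h l (chi B) x ^+ 2 + dminusR h l (chi B) x ^+ 2).
Definition sarea (h : R) (B : set pt) (x : pt) : R :=
  h ^+ 8 / 2 * Num.sqrt (Sigma h B x).
Definition nplus (h : R) (B : set pt) (l : 'I_8) (x : pt) : R :=
  - 2 * dplusR h l (chi B) x / Num.sqrt (Sigma h B x).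
Definition nminus (h : R) (B : set pt) (l : 'I_8) (x : pt) : R :=
  - 2 * dminusR h l (chi B) x / Num.sqrt (Sigma h B x).

(* iterated Lebesgue integral over [-pi,pi]^n of g : (nat -> R) -> R,
   integrating coordinates n-1, ..., 0 *)
Definition upd (v : nat -> R) (i : nat) (t : R) : nat -> R :=
  fun j => if j == i then t else v j.
Fixpoint cube_int (n : nat) (g : (nat -> R) -> R) (v : nat -> R) : R :=
  match n with
  | 0%N => g v
  | n'.+1 => Rintegral (@lebesgue_measure R) `[(- pi)%R, pi]
                (fun t => cube_int n' g (upd v n' t))
  end.

Definition E1_integrand (x : pt) (u : nat -> R) : oct :=
  (sin (\sum_(l < 8) u l * (x 0 l)%:~R) / \sum_(l < 8) sin (u l) ^+ 2)
    *: \sum_(l < 8) sin (u l) *: oconj (obasis l).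

Definition E1 (x : pt) : oct :=
  ((2 * pi) ^+ 8)^-1 *:
    \row_k cube_int 8 (fun u => E1_integrand x u 0 k) (fun _ => 0).

(* E^h(hz) = h^-7 E^1(z) *)
Definition Eh (h : R) (z : pt) : oct := h ^- 7 *: E1 z.

Definition Kstar (h : R) (B : set pt) (x y : pt) (g : pt -> oct) : oct :=
  - 2^-1 *: \sum_(l < 8)
     omul (nminus h B l x *: Eh h (ue l - x + y)
           + nplus h B l x *: Eh h (- ue l - x + y))
          (omul (obasis l) (g x)).

Definition CB (h : R) (B : set pt) (g : pt -> oct) (y : pt) : oct :=
  \sum_(x \in lbound B) sarea h B x *: Kstar h B x y g.

End Octonions.

(* Main.v *)
Require Import Defs.
From HB Require Import structures.
From mathcomp Require Import all_boot all_order all_algebra.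
From mathcomp Require Import all_classical all_reals all_analysis.
From mathcomp Require Import measurable_realfun zify ring lra.
Import Order.TTheory GRing.Theory Num.Theory numFieldNormedType.Exports.
Local Open Scope classical_set_scope.
Local Open Scope ring_scope.

(* Let S(u) be the sum of the sin^2 u_l.  Since |sin(u.x)| is at most the sum
   of the |x_l| |sin u_l|, the integrand of E^1 is bounded by the sum of the
   |x_l|, in spite of the zeros of S; hence the iterated integral is linear on
   all the functions involved.  The central difference of the k-th coordinate
   of E^1 in direction m is, up to sign, the integral of
   cos(u.x) sin u_m sin u_k / S, which is symmetric in m and k.  By the
   polarized alternative law
     e_m (conj e_k q) + e_k (conj e_m q) = 2 delta_mk q,
   D(E^1 q)(z) is therefore proportional to the integral of cos(u.z) times q,
   in spite of nonassociativity, and this vanishes for z <> 0.  In D(C f)(y)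
   the only terms left are those with x = y + e_l or x = y - e_l, whose normal
   coefficients vanish when y is an interior point of B or of its complement. *)

(** * Linearity of iterated integrals over the cube *)

Section CubeIntegral.
Variable R : realType.
Notation mu := (@lebesgue_measure R).
Notation I := `[(- @pi R)%R, @pi R]%classic.
Implicit Types g : (nat -> R) -> R.

(* Coordinatewise measurable parametrizations stand in for a sigma-algebra on
   [nat -> R]. *)
Definition nice g : Prop :=
  (exists M : R, forall u, `|g u| <= M) /\
  forall d (T : measurableType d) (phi : nat -> T -> R),
    (forall i, measurable_fun setT (phi i)) ->
    measurable_fun setT (fun t => g (fun i => phi i t)).

(** The indicator of [A] turns this into an integral over the whole line. Tonelli gives
    measurability for the positive and the negative part, and the real integral is [fine] of their
    difference. *)
Lemma measurable_param_Rintegral d (T : measurableType d) (A : set R)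
    (f : T * R -> R) :
  measurable A -> measurable_fun setT f ->
  measurable_fun setT (fun t => \int[mu]_(s in A) f (t, s)).
Proof.
move=> mA mf.
pose F (z : T * R) : \bar R := ((f z) * \1_A z.2)%:E.
have mF : measurable_fun setT F.
  apply/measurable_EFinP; apply: measurable_funM => //.
  have mI : measurable_fun setT (\1_A : R -> R) by exact: measurable_indic.
  exact: (measurableT_comp mI measurable_snd).
have -> : (fun t => \int[mu]_(s in A) f (t, s)) =
          fine \o (fubini_F mu F^\+ \- fubini_F mu F^\-)%E.
  apply/funext => t; rewrite /Rintegral /= /fubini_F.
  have e : (\int[mu]_(s in A) (f (t, s))%:E = \int[mu]_s F (t, s))%E.
    rewrite integral_mkcond; apply: eq_integral => s _; rewrite /F /= patchE indicE.
    by case: ifP; rewrite ?mulr1 ?mulr0.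
  rewrite e [in LHS]integralE; apply: (congr1 fine).
  by apply: (f_equal2 (fun a b => a - b)%E); apply: eq_integral => s _;
    rewrite ?funeposE ?funenegE.
apply: (measurableT_comp (f := fine)); first exact: fine_measurable.
apply: emeasurable_funB.
- apply: measurable_fun_fubini_tonelli_F => //; exact: measurable_funepos.
- apply: measurable_fun_fubini_tonelli_F => //; exact: measurable_funeneg.
Qed.

Lemma lebesgue_measure_cube_side : mu I = (2 * pi)%:E.
Proof.
rewrite lebesgue_measure_itv /= lte_fin gtrN ?pi_gt0 //.
by rewrite -EFinB opprK mulr2n mulrDl mul1r.
Qed.

Lemma bounded_integrable_I (f : R -> R) M :
  measurable_fun setT f -> (forall t, `|f t| <= M) ->
  mu.-integrable I (EFin \o f).
Proof.
move=> mf bf; apply: measurable_bounded_integrable => //.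
- by have /= -> := lebesgue_measure_cube_side; rewrite ltry.
- exact: (measurable_funS measurableT).
- exists M; split; first exact: num_real.
  by move=> x Mx t _; apply: le_trans (bf t) (ltW Mx).
Qed.

Lemma nice_upd g v i : nice g -> measurable_fun setT (fun t => g (upd v i t)).
Proof.
move=> [_ mg]; apply: (mg _ _ (fun j t => upd v i t j)) => j.
rewrite /upd; case: (j == i) => //; exact: measurable_id.
Qed.

Lemma nice_integrable g v i :
  nice g -> mu.-integrable I (EFin \o (fun t => g (upd v i t))).
Proof.
move=> ng; have [[M bM] _] := ng.
by apply: (bounded_integrable_I _ (M)) => //; exact: nice_upd.
Qed.

(** Each integration multiplies the bound by the length 2 pi of the side. This closure supplies the
    integrability needed for linearity at the next stage. *)
Lemma nice_cube_int n g : nice g -> nice (cube_int n g).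
Proof.
elim: n => [//|n IH] ng; have {}IH := IH ng; split.
- have [[M bM] _] := IH; exists (M * (2 * pi)) => u /=.
  have intg := nice_integrable _ u n IH.
  have mI : measurable I by [].
  apply: le_trans (@le_normr_Rintegral _ _ _ mu _
    (fun t => cube_int n g (upd u n t)) mI intg) _.
  have -> : M * (2 * pi) = \int[mu]_(_ in I) M.
    by rewrite (Rintegral_cst mu mI); have /= -> := lebesgue_measure_cube_side.
  apply: le_Rintegral => //.
  + exact: (integrable_norm intg).
  + by apply: (bounded_integrable_I _ `|M|) => //; exact: measurable_cst.
- move=> d T phi mphi /=.
  apply: (@measurable_param_Rintegral _ _ _
     (fun z : T * R => cube_int n g (upd (fun i => phi i z.1) n z.2))) => //.
  (* Adjoining the integration variable as coordinate [n] gives a measurable parametrization by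
     [T * R], to which the induction hypothesis applies. *)
  apply: (IH.2 _ _ (fun i z => upd (fun i => phi i z.1) n z.2 i)) => i.
  rewrite /upd; case: (i == n); first exact: measurable_snd.
  exact: measurableT_comp.
Qed.

Lemma eq_cube_int n g1 g2 : g1 =1 g2 -> cube_int n g1 =1 cube_int n g2.
Proof.
move=> e; elim: n => [//|n IH] v /=.
by apply: eq_Rintegral => t _; rewrite IH.
Qed.

Lemma cube_intD n g1 g2 v : nice g1 -> nice g2 ->
  cube_int n (fun u => g1 u + g2 u) v = cube_int n g1 v + cube_int n g2 v.
Proof.
move=> n1 n2; elim: n v => [//|n IH] v /=.
under eq_Rintegral do rewrite IH.
by rewrite RintegralD //; apply: nice_integrable; apply: nice_cube_int.
Qed.

Lemma cube_intZ n g c v : nice g ->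
  cube_int n (fun u => c * g u) v = c * cube_int n g v.
Proof.
move=> ng; elim: n v => [//|n IH] v /=.
under eq_Rintegral do rewrite IH.
by rewrite RintegralZl //; apply: nice_integrable; apply: nice_cube_int.
Qed.

Lemma niceD g1 g2 : nice g1 -> nice g2 -> nice (fun u => g1 u + g2 u).
Proof.
move=> [[M1 b1] m1] [[M2 b2] m2]; split.
  exists (M1 + M2) => u; exact: le_trans (ler_normD _ _) (lerD _ _).
by move=> d T phi mphi; apply: measurable_funD; [exact: m1|exact: m2].
Qed.

Lemma niceZ c g : nice g -> nice (fun u => c * g u).
Proof.
move=> [[M b] m]; split.
  by exists (`|c| * M) => u; rewrite normrM ler_wpM2l.
by move=> d T phi mphi; apply: measurable_funM => //; exact: m.
Qed.

Lemma nice0 : nice (fun=> 0).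
Proof. by split => [|? *]; [exists 0 => u; rewrite normr0|exact: measurable_cst]. Qed.

Lemma nice_sum (J : Type) (s : seq J) (F : J -> (nat -> R) -> R) :
  (forall j, nice (F j)) -> nice (fun u => \sum_(j <- s) F j u).
Proof.
move=> nF; elim: s => [|j s IH].
  by under eq_fun do rewrite big_nil; exact: nice0.
by under eq_fun do rewrite big_cons; exact: niceD.
Qed.

Lemma cube_int_sum n (J : Type) (s : seq J) (F : J -> (nat -> R) -> R) v :
  (forall j, nice (F j)) ->
  cube_int n (fun u => \sum_(j <- s) F j u) v = \sum_(j <- s) cube_int n (F j) v.
Proof.
move=> nF; elim: s => [|j s IH].
  rewrite big_nil -[RHS](mul0r (cube_int n (fun=> 0) v)) -cube_intZ; last exact: nice0.
  by apply: eq_cube_int => u; rewrite big_nil mul0r.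
rewrite big_cons -IH -cube_intD //; last exact: nice_sum.
by apply: eq_cube_int => u; rewrite big_cons.
Qed.

(** Inversion is continuous on the open complement of 0, and the singleton 0 is treated apart. *)
Lemma measurable_invr : measurable_fun setT (@GRing.inv R).
Proof.
rewrite -(setUCl [set (0 : R)]); apply/measurable_funU => //.
  exact: measurableC.
split.
  apply: open_continuous_measurable_fun; first exact: closed_openC.
  by move=> x; rewrite inE /= => /eqP x0; apply: inv_continuous.
exact: measurable_fun_set1.
Qed.

(** * Sine estimates and integrals of cosines of linear forms *)

Lemma ler_norm_sinD (a b : R) : `|sin (a + b)| <= `|sin a| + `|sin b|.
Proof.
rewrite sinD (le_trans (ler_normD _ _)) // !normrM lerD //.
- by rewrite ler_piMr // ler_norml cos_geN1 cos_le1.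
- by rewrite ler_piMl // ler_norml cos_geN1 cos_le1.
Qed.

(** Subadditivity of |sin|, iterated. A bound by |sin t| rather than |t| is what later compensates
    the zeros of [sinsq]. *)
Lemma ler_norm_sinMz (t : R) (m : int) :
  `|sin (t * m%:~R)| <= `|m|%:~R * `|sin t|.
Proof.
suff H (n : nat) : `|sin (t * n%:R)| <= n%:R * `|sin t|.
  case: m => n; first exact: H.
  by rewrite NegzE mulrNz mulrN sinN !normrN; exact: H.
elim: n => [|n IH]; first by rewrite mulr0 sin0 normr0 mul0r.
rewrite -natr1 mulrDr mulr1 mulrDl mul1r.
exact: le_trans (ler_norm_sinD _ _) (lerD IH (lexx _)).
Qed.

Lemma sin_pi_mulz (m : int) : sin (@pi R * m%:~R) = 0.
Proof.
apply/eqP; rewrite -normr_le0.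
by apply: le_trans (ler_norm_sinMz _ _) _; rewrite sinpi normr0 mulr0.
Qed.

Lemma Rintegral_cos_affine (A : R) (m : int) :
  \int[mu]_(t in I) cos (t * m%:~R + A) = (m == 0)%:R * (2 * pi) * cos A.
Proof.
have [->|m0] := eqVneq m 0.
  under eq_Rintegral do rewrite mulr0 add0r.
  rewrite Rintegral_cst //; have /= -> := lebesgue_measure_cube_side.
  by rewrite mul1r mulrC.
have mR0 : m%:~R != 0 :> R by rewrite intr_eq0.
pose F (t : R) := (m%:~R)^-1 * sin (t * m%:~R + A).
have dF (t : R) : is_derive t 1 F (cos (t * m%:~R + A)).
  rewrite /F; apply: is_derive_eq.
  rewrite /GRing.scale /=; field.
  by [].
rewrite /Rintegral (@continuous_FTC2 _ _ F) /=.
(* Both values are cos(pi m) sin(A) / m, because sin(pi m) = 0 and cosine is even. *)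
- have -> : F pi = F (- pi).
    by rewrite /F mulNr !sinD sinN cosN sin_pi_mulz oppr0.
  by rewrite subrr !mul0r.
- by rewrite gtrN // pi_gt0.
- apply: continuous_subspaceT => t.
  apply: continuous_comp; last exact: continuous_cos.
  by apply: continuousD;
    [apply: continuousM; [exact: cvg_id|exact: cvg_cst]|exact: cvg_cst].
- have cF t : F x @[x --> t] --> F t.
    apply: differentiable_continuous; apply/derivable1_diffP.
    exact: ex_derive.
  split.
  + by move=> t _; exact: ex_derive.
  + exact: cvg_at_right_filter.
  + exact: cvg_at_left_filter.
- by move=> t _; rewrite derive1E derive_val.
Qed.

Lemma mu_sin_zeros : exists N : set R,
  [/\ measurable N, mu N = 0%E & forall t, I t -> ~ N t -> sin t != 0].
Proof.
pose N : set R := [set - pi] `|` [set 0] `|` [set pi].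
have cN : countable N by apply: finite_set_countable; rewrite !finite_setU.
exists N; split.
- exact: countable_measurable.
- exact: countable_lebesgue_measure0.
- move=> t /=; rewrite in_itv /= => /andP[t1 t2] tnN.
  have tN : t != - pi by apply/eqP => e; apply: tnN; left; left.
  have t0 : t != 0 by apply/eqP => e; apply: tnN; left; right.
  have tp : t != pi by apply/eqP => e; apply: tnN; right.
  have {}t1 : - pi < t by rewrite lt_neqAle eq_sym tN.
  have {}t2 : t < pi by rewrite lt_neqAle tp.
  have [t3|t3|/esym/eqP] := ltgtP t 0; last by rewrite eq_sym (negPf t0).
  + rewrite -[t]opprK sinN oppr_eq0 gt_eqF // sin_gt0_pi //.
    by rewrite oppr_gt0 t3 ltrNl.
  + by rewrite gt_eqF // sin_gt0_pi // t3.
Qed.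

(** Coordinate 0 is integrated innermost, so the exceptional set is discarded in a one-dimensional
    integral, and the outer integrations then see equal functions. *)
Lemma cube_int_ae n g1 g2 v : nice g1 -> nice g2 ->
  (forall u, sin (u 0%N) != 0 -> g1 u = g2 u) ->
  cube_int n.+1 g1 v = cube_int n.+1 g2 v.
Proof.
move=> n1 n2 e; elim: n v => [|n IH] v; last first.
  by rewrite /=; apply: eq_Rintegral => t _; exact: IH.
rewrite /= /Rintegral; have [N [mN N0 zN]] := mu_sin_zeros.
have mI : measurable I by [].
congr fine.
rewrite (@negligible_integral _ _ _ mu I N (fun t => (g1 (upd v 0%N t))%:E)
  mN mI (nice_integrable _ v 0%N n1) N0).
rewrite (@negligible_integral _ _ _ mu I N (fun t => (g2 (upd v 0%N t))%:E)
  mN mI (nice_integrable _ v 0%N n2) N0).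
apply: eq_integral => t; rewrite inE => -[It Nt] /=.
by rewrite e // /upd eqxx zN.
Qed.

Definition lin (x : pt) (u : nat -> R) : R := \sum_(l < 8) u l * (x 0 l)%:~R.
Definition sinsq (u : nat -> R) : R := \sum_(l < 8) sin (u l) ^+ 2.

(** The coordinates not yet integrated act as a phase, so the result stays a multiple of a cosine.
    Coordinate i contributes the factor 2 pi if x_i = 0 and the factor 0 otherwise. *)
Lemma cube_int_cos_lin (x : pt) n : (n <= 8)%N ->
  exists2 c : R,
    forall v, cube_int n (fun u => cos (lin x u)) v =
              c * cos (\sum_(l < 8 | (n <= l)%N) v l * (x 0 l)%:~R)
  & forall l : 'I_8, (l < n)%N -> x 0 l != 0 -> c = 0.
Proof.
elim: n => [_|n IH n8]; first by exists 1 => // v; rewrite mul1r.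
have [c Hc c0] := IH (ltnW n8); pose i := Ordinal n8.
exists (c * ((x 0 i == 0)%:R * (2 * pi))) => [v|l]; last first.
  rewrite ltnS leq_eqVlt => /predU1P[ln|ln] xl; last by rewrite (c0 l) ?mul0r.
  have -> : i = l by exact: val_inj.
  by rewrite (negPf xl) mul0r mulr0.
(* The term of index [n] carries the integration variable; the higher ones form the phase. *)
have Hsum t : \sum_(l < 8 | (n <= l)%N) upd v n t l * (x 0 l)%:~R =
    t * (x 0 i)%:~R + \sum_(l < 8 | (n < l)%N) v l * (x 0 l)%:~R.
  rewrite (bigD1 i) //= /upd eqxx; congr (_ + _).
  apply: eq_big => l; last first.
    by move=> /andP[_ li]; rewrite ifN.
  by rewrite ltn_neqAle andbC -val_eqE /= eq_sym.
rewrite /=; under eq_Rintegral do rewrite Hc Hsum.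
rewrite RintegralZl //; first by rewrite Rintegral_cos_affine !mulrA.
apply: (bounded_integrable_I _ 1).
  apply: continuous_measurable_fun => t.
  apply: continuous_comp; last exact: continuous_cos.
  by apply: continuousD;
    [apply: continuousM; [exact: cvg_id|exact: cvg_cst]|exact: cvg_cst].
by move=> t; rewrite ler_norml cos_geN1 cos_le1.
Qed.

Lemma cube_int_cos0 (x : pt) v : x != 0 ->
  cube_int 8 (fun u => cos (lin x u)) v = 0.
Proof.
move=> x0; have [c Hc c0] := cube_int_cos_lin x 8 isT.
rewrite Hc; have [l xl] : exists l, x 0 l != 0.
  apply: contrapT => H; case/eqP: x0; apply/rowP => l; rewrite mxE.
  by apply/eqP; apply: contrapT => /negP xl; apply: H; exists l.
by rewrite (c0 l) ?mul0r.
Qed.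

End CubeIntegral.

(** * The integrand of the fundamental solution and its central differences *)

Section Kernel.
Variable R : realType.
Notation v0 := (fun=> 0 : R).

(** Coordinate k of the integrand of E^1, without the sign coming from conjugation. *)
Definition kern (x : pt) (k : 'I_8) (u : nat -> R) : R :=
  sin (lin R x u) / sinsq R u * sin (u k).

(** Half of the difference of [kern] between z + e_m and z - e_m, by the addition formulas for
    sine. *)
Definition dkern (z : pt) (m k : 'I_8) (u : nat -> R) : R :=
  cos (lin R z u) / sinsq R u * (sin (u m) * sin (u k)).

(** The product is at most the mean of the two squares. Each square is bounded by the whole sum
    separately, which covers m = k as well. *)
Lemma ler_norm_sin2 (u : nat -> R) (m k : 'I_8) :
  `|sin (u m)| * `|sin (u k)| <= sinsq R u.
Proof.
have H (l : 'I_8) : `|sin (u l)| ^+ 2 <= sinsq R u.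
  rewrite real_normK ?num_real // /sinsq (bigD1 l) //= lerDl.
  by apply: sumr_ge0 => i _; exact: sqr_ge0.
have := H m; have := H k; have := sqr_ge0 (`|sin (u m)| - `|sin (u k)|).
nra.
Qed.

Lemma sinsq_ge0 (u : nat -> R) : 0 <= sinsq R u.
Proof. by apply: sumr_ge0 => i _; exact: sqr_ge0. Qed.

Lemma ler_norm_sin_lin (x : pt) (u : nat -> R) :
  `|sin (lin R x u)| <= \sum_(l < 8) `|x 0 l|%:~R * `|sin (u l)|.
Proof.
rewrite /lin; elim/big_ind2: _ => [|a b c d ab cd|l _].
- by rewrite sin0 normr0.
- exact: le_trans (ler_norm_sinD _ _ _) (lerD ab cd).
- exact: ler_norm_sinMz.
Qed.

(** Where S vanishes, the convention that the inverse of 0 is 0 makes the quotient 0, so the bound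
    extends to the singular points. *)
Lemma ler_norm_quot (a b c S : R) : 0 <= S -> 0 <= c ->
  `|a| * `|b| <= c * S -> `|a / S * b| <= c.
Proof.
move=> S0 c0 H; have [->|SN] := eqVneq S 0; first by rewrite invr0 mulr0 mul0r normr0.
have Sp : 0 < S by rewrite lt_neqAle eq_sym SN.
by rewrite mulrAC normrM normfV (ger0_norm S0) ler_pdivrMr // normrM.
Qed.

Lemma measurable_lin d (T : measurableType d) (phi : nat -> T -> R) (x : pt) :
  (forall i, measurable_fun setT (phi i)) ->
  measurable_fun setT (fun t => lin R x (fun i => phi i t)).
Proof.
move=> mphi; apply: (@measurable_sum _ _ _ _ _ _
  (fun l t => phi (nat_of_ord l) t * (x 0 l)%:~R)) => l.
exact: measurable_funM.
Qed.

Lemma measurable_sinsq d (T : measurableType d) (phi : nat -> T -> R) :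
  (forall i, measurable_fun setT (phi i)) ->
  measurable_fun setT (fun t => (sinsq R (fun i => phi i t))^-1).
Proof.
move=> mphi; apply: (measurableT_comp (measurable_invr R)).
apply: (@measurable_sum _ _ _ _ _ _
  (fun l t => sin (phi (nat_of_ord l) t) ^+ 2)) => l.
apply: (measurable_funX 2).
exact: (measurableT_comp (continuous_measurable_fun (@continuous_sin R))).
Qed.

Lemma nice_kern x k : nice R (kern x k).
Proof.
split.
  exists (\sum_(l < 8) `|x 0 l|%:~R) => u.
  apply: ler_norm_quot; first exact: sinsq_ge0.
    by apply: sumr_ge0 => l _; rewrite ler0z.
  apply: le_trans (ler_wpM2r _ (ler_norm_sin_lin x u)) _ => //.
  rewrite !mulr_suml; apply: ler_sum => l _.
  by rewrite -mulrA ler_wpM2l ?ler0z // ler_norm_sin2.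
move=> d T phi mphi; apply: measurable_funM; last first.
  exact: (measurableT_comp (continuous_measurable_fun (@continuous_sin R))).
apply: measurable_funM; last exact: measurable_sinsq.
apply: (measurableT_comp (continuous_measurable_fun (@continuous_sin R))).
exact: measurable_lin.
Qed.

Lemma measurable_cos_lin d (T : measurableType d) (phi : nat -> T -> R) (x : pt) :
  (forall i, measurable_fun setT (phi i)) ->
  measurable_fun setT (fun t => cos (lin R x (fun i => phi i t))).
Proof.
move=> mphi; apply: (measurableT_comp (continuous_measurable_fun (@continuous_cos R))).
exact: measurable_lin.
Qed.

Lemma nice_cos_lin x : nice R (fun u => cos (lin R x u)).
Proof.
split; first by exists 1 => u; rewrite ler_norml cos_geN1 cos_le1.
by move=> d T phi mphi; exact: measurable_cos_lin.
Qed.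

Lemma nice_dkern z m k : nice R (dkern z m k).
Proof.
split.
  exists 1 => u; apply: ler_norm_quot => //; first exact: sinsq_ge0.
  rewrite mul1r normrM (le_trans _ (ler_norm_sin2 u m k)) // ler_piMl //.
  by rewrite ler_norml cos_geN1 cos_le1.
move=> d T phi mphi; apply: measurable_funM; last first.
  apply: measurable_funM;
  exact: (measurableT_comp (continuous_measurable_fun (@continuous_sin R))).
apply: measurable_funM; last exact: measurable_sinsq.
exact: measurable_cos_lin.
Qed.

Lemma linD (x y : pt) u : lin R (x + y) u = lin R x u + lin R y u.
Proof.
by rewrite /lin -big_split; apply: eq_bigr => l _; rewrite mxE intrD mulrDr.
Qed.

Lemma lin_ue m u : lin R (ue m) u = u m.
Proof.
rewrite /lin (bigD1 m) //= mxE eqxx mulr1 big1 ?addr0 // => i im.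
by rewrite mxE (negPf im) mulr0.
Qed.

Lemma linN x u : lin R (- x) u = - lin R x u.
Proof.
by rewrite /lin -sumrN; apply: eq_bigr => l _; rewrite mxE intrN mulrN.
Qed.

Lemma cube_int_kernB z m k v :
  cube_int 8 (kern (z + ue m) k) v - cube_int 8 (kern (z - ue m) k) v =
  2 * cube_int 8 (dkern z m k) v.
Proof.
rewrite -mulN1r -!cube_intZ -?cube_intD; try exact: nice_kern; try exact: nice_dkern.
  apply: eq_cube_int => u; rewrite /kern /dkern !linD linN lin_ue sinB sinD; ring.
by apply: niceZ; exact: nice_kern.
Qed.

Lemma cube_int_dkernC z m k v :
  cube_int 8 (dkern z m k) v = cube_int 8 (dkern z k m) v.
Proof. by apply: eq_cube_int => u; rewrite /dkern (mulrC (sin (u m))). Qed.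

(** On the diagonal the squared sines add up to the denominator, leaving cos(u.z) almost everywhere,
    whose integral over the cube vanishes for nonzero z. *)
Lemma cube_int_dkern_trace z v : z != 0 ->
  \sum_(m < 8) cube_int 8 (dkern z m m) v = 0.
Proof.
move=> z0; rewrite -cube_int_sum; last by move=> m; exact: nice_dkern.
rewrite -[RHS](cube_int_cos0 R z v z0); apply: cube_int_ae.
- by apply: (nice_sum _ _ _ (fun m => dkern z m m)) => m; exact: nice_dkern.
- exact: nice_cos_lin.
(* A nonzero sin u_0 already makes the denominator positive, so a null set in coordinate 0 is all
   that has to be discarded. *)
- move=> u u0; rewrite /dkern -mulr_sumr -mulrA [X in _ * (_ * X)](_ : _ = sinsq R u).
    rewrite mulVf ?mulr1 // gt_eqF // /sinsq big_ord_recl ltr_pwDl //.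
      by rewrite exprn_even_gt0.
    by apply: sumr_ge0 => i _; exact: sqr_ge0.
  by apply: eq_bigr => m _; rewrite expr2.
Qed.

End Kernel.

(** * Octonion multiplication and the polarized alternative law *)

Section OctonionAlgebra.
Variable R : realType.
Implicit Types a b q : oct R.

Lemma omulDl a b q : omul (a + b) q = omul a q + omul b q.
Proof.
apply/rowP => r; rewrite !mxE -big_split; apply: eq_bigr => i _.
rewrite -big_split; apply: eq_bigr => j _; rewrite mxE /=; ring.
Qed.

Lemma omulDr a b q : omul q (a + b) = omul q a + omul q b.
Proof.
apply/rowP => r; rewrite !mxE -big_split; apply: eq_bigr => i _.
rewrite -big_split; apply: eq_bigr => j _; rewrite mxE /=; ring.
Qed.

Lemma omulZl c a b : omul (c *: a) b = c *: omul a b.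
Proof.
apply/rowP => r; rewrite !mxE mulr_sumr; apply: eq_bigr => i _.
rewrite mulr_sumr; apply: eq_bigr => j _; rewrite mxE; ring.
Qed.

Lemma omulZr c a b : omul a (c *: b) = c *: omul a b.
Proof.
apply/rowP => r; rewrite !mxE mulr_sumr; apply: eq_bigr => i _.
rewrite mulr_sumr; apply: eq_bigr => j _; rewrite mxE; ring.
Qed.

Lemma omul0 a : omul a 0 = 0.
Proof. by rewrite -(scale0r 0) omulZr !scale0r. Qed.

Lemma omul0l a : omul 0 a = 0.
Proof. by rewrite -(scale0r 0) omulZl !scale0r. Qed.

Lemma omul_suml (J : Type) (s : seq J) (F : J -> oct R) b :
  omul (\sum_(j <- s) F j) b = \sum_(j <- s) omul (F j) b.
Proof.
elim: s => [|j s IH]; first by rewrite !big_nil omul0l.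
by rewrite !big_cons omulDl IH.
Qed.

Lemma omul_sumr (J : Type) (s : seq J) (F : J -> oct R) b :
  omul b (\sum_(j <- s) F j) = \sum_(j <- s) omul b (F j).
Proof.
elim: s => [|j s IH]; first by rewrite !big_nil omul0.
by rewrite !big_cons omulDr IH.
Qed.

Definition csign (k : nat) : int := if k == 0%N then 1 else -1.

(** Integer structure constants with natural indices, which evaluate by computation, unlike those in
    an abstract real field. *)
Definition omul_coefz (i j k : nat) : int :=
  if i == 0%N then (j == k)%:Z
  else if j == 0%N then (i == k)%:Z
  else if i == j then - (k == 0%N)%:Z
  else if cyc_in i j k then 1 else if cyc_in j i k then -1 else 0.

Lemma omul_coefE (i j k : 'I_8) : omul_coef R i j k = (omul_coefz i j k)%:~R.
Proof.
rewrite /omul_coef /omul_coefz /eps -!val_eqE.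
case: ifP => _; first by case: eqP.
case: ifP => _; first by case: eqP.
case: ifP => _; first by rewrite mulrNz; case: eqP.
by case: ifP => // _; case: ifP.
Qed.

(** Compares the e_r-coefficient of e_m (conj e_k e_j) + e_k (conj e_m e_j) with 2 delta_mk delta_jr
    for all indices; p indexes the coordinates of the inner products. Lists replace big operators so
    that the test reduces. *)
Definition clifford_check : bool :=
  all (fun m => all (fun k => all (fun j => all (fun r =>
    foldr (fun p s => csign k * omul_coefz k j p * omul_coefz m p r +
                      csign m * omul_coefz m j p * omul_coefz k p r + s) 0 (iota 0 8)
    == (2 * (m == k) * (j == r))%:Z)
  (iota 0 8)) (iota 0 8)) (iota 0 8)) (iota 0 8).

Lemma clifford_checkT : clifford_check.
Proof. by vm_compute. Qed.

Lemma omul_coefz_clifford (m k j r : 'I_8) :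
  \sum_(p < 8) (csign k * omul_coefz k j p * omul_coefz m p r +
                csign m * omul_coefz m j p * omul_coefz k p r) =
  (2 * (m == k) * (j == r))%:Z.
Proof.
have I8 (i : 'I_8) : (i : nat) \in iota 0 8 by rewrite mem_iota ltn_ord.
have /allP/(_ _ (I8 m))/allP/(_ _ (I8 k))
  /allP/(_ _ (I8 j))/allP/(_ _ (I8 r))/eqP := clifford_checkT.
rewrite -!val_eqE => <-.
rewrite -(big_mkord xpredT (fun p => csign k * omul_coefz k j p * omul_coefz m p r +
                csign m * omul_coefz m j p * omul_coefz k p r)) /index_iota subn0.
by elim: (iota 0 8) => [|p s IH]; rewrite ?big_nil // big_cons IH.
Qed.

Lemma oconj_obasis (k l : 'I_8) :
  oconj (obasis R k) 0 l = (csign l)%:~R * (l == k)%:R.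
Proof. by rewrite !mxE /csign; case: ifP => _; rewrite ?mul1r // mulN1r. Qed.

(** The factor [c] serves both e_k, with c = 1, and its conjugate, with c = [csign k]. *)
Lemma omul_delta (c : R) a (k r : 'I_8) b :
  (forall i, a 0 i = c * (i == k)%:R) ->
  omul a b 0 r = c * \sum_(j < 8) b 0 j * (omul_coefz k j r)%:~R.
Proof.
move=> ha; rewrite mxE (bigD1 k) //= [X in _ + X]big1 ?addr0; last first.
  by move=> i ik; rewrite big1 // => j _; rewrite ha (negPf ik) mulr0 !mul0r.
rewrite mulr_sumr; apply: eq_bigr => j _.
by rewrite ha eqxx mulr1 omul_coefE mulrA.
Qed.

(** This Clifford relation between left multiplications stands in for associativity. By linearity in
    q it suffices to take q = e_j, which is the finite check above. *)
Lemma omul_clifford (m k : 'I_8) q :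
  omul (obasis R m) (omul (oconj (obasis R k)) q) +
  omul (obasis R k) (omul (oconj (obasis R m)) q) = (2 * (m == k))%:R *: q.
Proof.
have ob (l i : 'I_8) : obasis R l 0 i = 1 * (i == l)%:R by rewrite mxE mul1r.
have oc (l i : 'I_8) : oconj (obasis R l) 0 i = (csign l)%:~R * (i == l)%:R.
  by rewrite oconj_obasis; case: eqP => [->|]; rewrite ?mulr0.
apply/rowP => r; rewrite mxE !(omul_delta _ _ _ _ _ (ob _)) !mul1r.
under eq_bigr do rewrite (omul_delta _ _ _ _ _ (oc _)) mulr_sumr mulr_suml.
under [in X in _ + X]eq_bigr do rewrite (omul_delta _ _ _ _ _ (oc _)) mulr_sumr mulr_suml.
(* The coordinate j of q becomes the outer index, and the intermediate index p the inner one, as in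
   [omul_coefz_clifford]. *)
rewrite exchange_big /= [X in _ + X]exchange_big -big_split /=.
transitivity (\sum_(j < 8) q 0 j * (2 * (m == k) * (j == r))%:R); last first.
  rewrite (bigD1 r) //= eqxx muln1 big1 ?addr0; last first.
    by move=> j jr; rewrite (negPf jr) muln0 mulr0.
  by rewrite mxE mulrC.
apply: eq_bigr => j _.
rewrite -big_split /= -[X in _ = _ * X]/((2 * (m == k) * (j == r))%:Z%:~R).
rewrite -omul_coefz_clifford.
rewrite rmorph_sum mulr_sumr; apply: eq_bigr => p _.
rewrite rmorphD !rmorphM /=; ring.
Qed.

End OctonionAlgebra.

(** * Neighbours, interiors and boundaries in the lattice *)

Section LatticeSets.
Implicit Types (B : set pt) (y : pt).

(** A neighbour outside [B], together with [y] itself, would put [y] on the boundary. *)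
Lemma linterior_nbh B y x : linterior B y -> nbh y x -> B x.
Proof.
move=> [By yB] yx; apply: contrapT => nBx; apply: yB; split.
  by exists y => //; left.
by exists x.
Qed.

Lemma nbhDue y l : nbh y (y + ue l).
Proof. by right; exists l; left. Qed.

Lemma nbhBue y l : nbh y (y - ue l).
Proof. by right; exists l; right. Qed.

Lemma chi_nbh_const (R : realType) B y x :
  linterior B y \/ linterior (~` B) y -> nbh y x -> chi R B x = chi R B y.
Proof.
have yy : nbh y y by left.
move=> [yB|yB] yx; rewrite /chi !indicE.
  by rewrite !mem_set //; apply: linterior_nbh yB _.
by rewrite !memNset //; apply: linterior_nbh yB _.
Qed.

(** This turns the sum in [CB] into an ordinary sum over a list, through which the difference
    operator passes. *)
Lemma finite_lbound B : lbounded B -> finite_set (Defs.lbound B).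
Proof.
move=> [M HM].
(* A boundary point has a neighbour in [B], so its coordinates lie between -(M+1) and M+1, a range
   of 2(M+1)+1 integers. *)
pose f (w : {ffun 'I_8 -> 'I_(2 * M.+1).+1}) : pt := \row_i ((w i)%:Z - M.+1%:Z).
apply: (@sub_finite_set _ _ (range f)); last exact/finite_image/finite_finset.
move=> x [[y xy By] _].
have Hx i : `|x 0 i| <= M.+1%:Z.
  have := HM y By i; rewrite natz; case: xy => [->|[l [->|->]]]; first by lia.
  - rewrite !mxE natz; case: (i == l); move: (x 0 i) => a; lia.
  - rewrite !mxE natz; case: (i == l); move: (x 0 i) => a; lia.
exists [ffun i => inord (absz (x 0 i + M.+1%:Z))] => //.
apply/rowP => i; rewrite mxE ffunE inordK; have := Hx i; lia.
Qed.

End LatticeSets.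

(** * The operator D^h applied to the fundamental solution and to the Cauchy-Bitsadze operator *)

Section CauchyBitsadze.
Variable R : realType.
Implicit Types (h : R) (F G : pt -> oct R) (q : oct R).

Lemma dcenE h m F x :
  dcen h m F x = (2^-1 * h^-1) *: (F (x + ue m) - F (x - ue m)).
Proof. by rewrite /dcen /dplus /dminus -scalerDr addrA subrK scalerA. Qed.

Lemma DhE h F x :
  Dh h F x = (2^-1 * h^-1) *:
    \sum_(m < 8) omul (obasis R m) (F (x + ue m) - F (x - ue m)).
Proof. by rewrite scaler_sumr; apply: eq_bigr => m _; rewrite dcenE omulZr. Qed.

Lemma DhD h F G x : Dh h (fun y => F y + G y) x = Dh h F x + Dh h G x.
Proof.
rewrite !DhE -scalerDr -big_split; congr (_ *: _); apply: eq_bigr => m _.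
by rewrite /= -omulDr addrACA opprD.
Qed.

Lemma DhZ h c F x : Dh h (fun y => c *: F y) x = c *: Dh h F x.
Proof.
rewrite !DhE [RHS]scalerA [c * _]mulrC -[RHS]scalerA [X in _ = _ *: X]scaler_sumr.
congr (_ *: _).
by apply: eq_bigr => m _; rewrite -scalerBr omulZr.
Qed.

Lemma Dh_sum h (J : Type) (s : seq J) (F : J -> pt -> oct R) x :
  Dh h (fun y => \sum_(j <- s) F j y) x = \sum_(j <- s) Dh h (F j) x.
Proof.
rewrite DhE; under [RHS]eq_bigr do rewrite DhE.
rewrite -scaler_sumr exchange_big; congr (_ *: _); apply: eq_bigr => m _.
by rewrite -sumrB omul_sumr.
Qed.

Lemma eq_Dh h F G x : (forall y, nbh x y -> F y = G y) -> Dh h F x = Dh h G x.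
Proof.
move=> FG; rewrite !DhE; congr (_ *: _); apply: eq_bigr => m _.
by rewrite !FG //; [exact: nbhBue|exact: nbhDue].
Qed.

Lemma E1_coord (x : pt) (k : 'I_8) :
  E1 R x 0 k = ((2 * pi) ^+ 8)^-1 *
    ((csign k)%:~R * cube_int 8 (kern R x k) (fun=> 0)).
Proof.
have H : (fun u => E1_integrand x u 0 k) =1 (fun u => (csign k)%:~R * kern R x k u).
  move=> u; rewrite /E1_integrand -/(lin R x u) -/(sinsq R u) mxE summxE.
  rewrite (bigD1 k) //= big1 ?addr0; last first.
    by move=> l lk; rewrite mxE oconj_obasis eq_sym (negPf lk) !mulr0.
  by rewrite mxE oconj_obasis eqxx mulr1 /kern mulrA [RHS]mulrC.
by rewrite /E1 2!mxE (eq_cube_int _ _ _ _ H) cube_intZ //; exact: nice_kern.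
Qed.

Lemma E1_central_diff (z : pt) (m : 'I_8) :
  E1 R (z + ue m) - E1 R (z - ue m) =
  (((2 * pi) ^+ 8)^-1 * 2) *:
    \sum_(k < 8) cube_int 8 (dkern R z m k) (fun=> 0) *: oconj (obasis R k).
Proof.
apply/rowP => k.
have := E1_coord (z + ue m) k; have := E1_coord (z - ue m) k.
have := cube_int_kernB R z m k (fun=> 0).
set G := fun k => cube_int 8 (dkern R z m k) (fun=> 0).
rewrite -/(G k) (eq_bigr (fun k => G k *: oconj (obasis R k))) //.
move: G (cube_int 8 (kern R (z + ue m) k) _) (cube_int 8 (kern R (z - ue m) k) _).
move: (E1 R (z + ue m)) (E1 R (z - ue m)) => a b G c d H3 H2 H1.
rewrite mxE H1 [X in _ + X]mxE H2 mxE summxE.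
rewrite (bigD1 k) //= big1 ?addr0; last first.
  by move=> l lk; rewrite mxE oconj_obasis eq_sym (negPf lk) !mulr0.
rewrite mxE oconj_obasis eqxx mulr1 -mulrBr -mulrBr H3; ring.
Qed.

(** The central differences pair a symmetric matrix [G] of integrals with the octonions [T m k].
    Only the symmetric part of [T] matters; it equals delta_mk q by [omul_clifford], so the sum is
    the trace of [G] times q, and this trace is 0 because a + y is nonzero. *)
Lemma Dh_E1_mul h (a y : pt) q : a + y != 0 ->
  Dh h (fun y => omul (E1 R (a + y)) q) y = 0.
Proof.
move=> z0; set z := a + y; pose G m k := cube_int 8 (dkern R z m k) (fun=> 0).
pose T (m k : 'I_8) := omul (obasis R m) (omul (oconj (obasis R k)) q).
suff S0 : \sum_(m < 8) \sum_(k < 8) G m k *: T m k = 0.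
  rewrite DhE (_ : \sum_(m < 8) _ = (((2 * pi) ^+ 8)^-1 * 2) *:
    \sum_(m < 8) \sum_(k < 8) G m k *: T m k); first by rewrite S0 !scaler0.
  rewrite scaler_sumr; apply: eq_bigr => m _; rewrite !addrA -/z.
  rewrite -[- omul _ _]scaleN1r -omulZl scaleN1r -omulDl E1_central_diff.
  rewrite omulZl omulZr omul_suml omul_sumr; congr (_ *: _).
  by apply: eq_bigr => k _; rewrite omulZl omulZr.
have GC m k : G m k = G k m by exact: cube_int_dkernC.
have G0 : \sum_(m < 8) G m m = 0 by exact: cube_int_dkern_trace.
clearbody G; have S2 : \sum_(m < 8) \sum_(k < 8) G m k *: (T m k + T k m) = 0.
  transitivity ((2 * \sum_(m < 8) G m m) *: q).
    rewrite mulr_sumr scaler_suml; apply: eq_bigr => m _.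
    rewrite (bigD1 m) //= big1 ?addr0.
      by rewrite omul_clifford eqxx muln1 scalerA mulrC.
    move=> k km; rewrite omul_clifford eq_sym (negPf km) muln0 scale0r.
    exact: scaler0.
  by rewrite G0 mulr0 scale0r.
apply: (@scalerI _ _ (2 : R)); first by rewrite pnatr_eq0.
(* Twice the double sum is the sum plus its copy with m and k exchanged. *)
rewrite scaler0 -[RHS]S2 scaler_nat mulr2n [X in _ + X]exchange_big -big_split.
apply: eq_bigr => m _; rewrite -big_split; apply: eq_bigr => k _ /=.
by rewrite scalerDr (GC k m).
Qed.

Lemma Dh_Eh_mul h (a y : pt) q : a + y != 0 ->
  Dh h (fun y => omul (Eh h (a + y)) q) y = 0.
Proof.
move=> z0; rewrite (_ : (fun y => _) = fun y => h ^- 7 *: omul (E1 R (a + y)) q).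
  by rewrite DhZ Dh_E1_mul // scaler0.
by apply/funext => x; rewrite omulZl.
Qed.

Lemma Dh_Kstar h B g x y : linterior B y \/ linterior (~` B) y ->
  Dh h (fun y => Kstar h B x y g) y = 0.
Proof.
move=> yB; rewrite /Kstar DhZ Dh_sum big1 ?scaler0 // => l _.
(* The shifted kernel meets the origin only at x = y + e_l, where this normal coefficient compares
   [chi] at y + e_l and at y, so it vanishes. *)
have nm : nminus h B l x = 0 \/ ue l - x + y != 0.
  have [e|] := eqVneq (ue l - x + y) 0; [left|by right].
  have -> : x = y + ue l by rewrite -[LHS]add0r -e addrAC subrK addrC.
  rewrite /nminus /dminusR addrK (chi_nbh_const _ _ _ _ yB (nbhDue _ _)).
  by rewrite subrr !(mul0r, mulr0).
(* Likewise at x = y - e_l, with [chi] compared at y and at y - e_l. *)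
have np : nplus h B l x = 0 \/ - ue l - x + y != 0.
  have [e|] := eqVneq (- ue l - x + y) 0; [left|by right].
  have -> : x = y - ue l by rewrite -[LHS]add0r -e addrAC subrK addrC.
  rewrite /nplus /dplusR subrK (chi_nbh_const _ _ _ _ yB (nbhBue _ _)).
  by rewrite subrr !(mul0r, mulr0).
set q := omul _ (g x).
pose F1 z := omul (Eh h (ue l - x + z)) q.
pose F2 z := omul (Eh h (- ue l - x + z)) q.
have -> : (fun y => omul (nminus h B l x *: Eh h (ue l - x + y) +
    nplus h B l x *: Eh h (- ue l - x + y)) q) =
    fun y => nminus h B l x *: F1 y + nplus h B l x *: F2 y.
  apply/funext => z; rewrite /F1 /F2; move: (Eh _ _) (Eh _ _) => a b.
  by rewrite omulDl !omulZl.
have F10 : ue l - x + y != 0 -> Dh h F1 y = 0 by exact: Dh_Eh_mul.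
have F20 : - ue l - x + y != 0 -> Dh h F2 y = 0 by exact: Dh_Eh_mul.
clearbody F1 F2; rewrite DhD !DhZ.
case: nm => [->|/F10 ->]; case: np => [->|/F20 ->];
  by rewrite ?scale0r ?scaler0 addr0.
Qed.

Lemma Dh_CB h B g y : lbounded B -> linterior B y \/ linterior (~` B) y ->
  Dh h (CB h B g) y = 0.
Proof.
move=> bB yB; have fB := finite_lbound B bB.
rewrite (_ : CB h B g = fun y => \sum_(x <- finmap.enum_fset (fset_set (Defs.lbound B)))
    sarea h B x *: Kstar h B x y g); last first.
  by apply/funext => z; rewrite /CB fsbig_finite.
by rewrite Dh_sum big1 // => x _; rewrite DhZ Dh_Kstar // scaler0.
Qed.

End CauchyBitsadze.

Theorem mainTheorem8 (R : realType) (h : R) (B : set pt) (f : pt -> oct R) :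
  0 < h -> lbounded B ->
  (forall y : pt, linterior B y \/ linterior (~` B) y ->
     Dh h (CB h B f) y = 0)
  /\
  ((forall y : pt, B y -> f y = CB h B f y) ->
     forall y : pt, linterior B y -> Dh h f y = 0).
Proof.
move=> _ bB; split=> [y yB|fB y yB]; first exact: Dh_CB.
(* D^h at an interior point sees only neighbours, all of them in [B], where f agrees with its
   transform; (ii) thus reduces to (i). *)
rewrite (eq_Dh _ _ _ (CB h B f)); first by apply: Dh_CB => //; left.
by move=> x yx; apply: fB; apply: linterior_nbh yB yx.
Qed.
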